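(* Let $n\ge1$. For any nonempty $I\subset[n]$ and integer $m\ge0$, \[ \mathbb{P}\big(C_I(\sigma)=m\big)\le\frac{e^{H_n-H(I)}}{n}\cdot\frac{H(I)^m}{m!}\left(\mathbf{1}(I\ne[n])+\frac{m}{H(I)}\right). \] In particular, \[ \mathbb{P}\big(C_I(\sigma)=0\big)\le\frac{e^{H_n-H(I)}}{n}=e^{\gamma-H(I)}\big(1+O(1/n)\big). \]
   Context: $[n]=\{1,\ldots,n\}$; $I\subset[n]$ allows $I=[n]$. The probability $\mathbb{P}$ is with respect to a uniformly random permutation $\sigma$ in the symmetric group $\mathcal{S}_n$ on $[n]$. $C_I(\sigma)$ is the number of cycles of $\sigma$ whose lengths lie in $I$ (fixed points count as cycles of length 1), $H(I)=\sum_{j\in I}1/j$, $H_n=\sum_{i=1}^n1/i$, and $\gamma$ is Euler's constant. $\mathbf{1}(S)$ is $1$ if the statement $S$ is true and $0$ otherwise. The constant implied by $O(1/n)$ is absolute. *)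

(* Defs.v *)
From mathcomp Require Import filter reals topology normedtype sequences exp.
From mathcomp Require Import all_boot all_order all_algebra all_fingroup.

Set Implicit Arguments.
Unset Strict Implicit.
Unset Printing Implicit Defensive.

Import Order.TTheory GRing.Theory Num.Theory.
Import numFieldNormedType.Exports.

Local Open Scope ring_scope.

(* A set I of cycle lengths, I \subset {1, ..., n}, is encoded as a
   {set 'I_n} in which the ordinal i stands for the length i.+1; accordingly
   harmonic i = 1 / (i + 1) is the reciprocal of that length. *)

(* C_I(s): porbits s contains the singleton orbits of the fixed points. *)
Definition cycle_count (n : nat) (I : {set 'I_n}) (s : 'S_n) : nat :=
  #|[set c in porbits s | [exists i in I, #|c| == i.+1]]|.

Definition uniform_prob (R : realType) (n : nat) (E : pred 'S_n) : R :=
  #|[set s | E s]|%:R / #|{: 'S_n}|%:R.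

Definition Hset (R : realType) (n : nat) (I : {set 'I_n}) : R :=
  \sum_(i in I) harmonic i.

(* H_n = 1 + 1/2 + ... + 1/n *)
Definition Hnum (R : realType) (n : nat) : R := series harmonic n.

Definition euler_gamma (R : realType) : R :=
  limn (fun n : nat => Hnum R n - ln n%:R).

(* Main.v *)
Require Import Defs.
From mathcomp Require Import classical_sets functions filter reals topology normedtype sequences exp derive realfun.
From mathcomp Require Import all_boot all_order all_algebra all_fingroup.
From mathcomp Require Import ring lra.

Import Order.TTheory GRing.Theory Num.Theory.
Local Open Scope ring_scope.
Set Implicit Arguments.
Unset Strict Implicit.
Unset Printing Implicit Defensive.
Import numFieldNormedType.Exports.

(** Let p_k(m) be the probability that a uniform permutation of k points has
    exactly m cycles with length in I, and write A for H_n - H(I) and B for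
    H(I).

    The cycle through a given point of a random permutation of k points has a
    uniform length in {1, ..., k}, and what remains is a uniform permutation
    of the other points, so that

      k p_k(m) = sum_(1 <= j <= k) p_(k - j)(m - [j in I]).

    This is [cycle_distS]. It comes from the stronger weighted identity
    [cycle_index_split]: the sum, over all permutations of a finite set, of the
    product of w(length) over the cycles splits according to the cycle
    containing a given point. Taking 'X as the weight of the lengths in I and
    1 as the weight of the other ones makes the coefficients of that sum count
    permutations by their number of cycles with length in I.

    Taking k = n, the recurrence bounds n p_n(m) by the sum S_(m-1) of all
    p_k(m-1), k < n, plus, when I is not everything, the sum S_m of all p_k(m),
    k < n ([cycle_dist_le]). The theorem then follows from
    S_m <= e^A B^m / m! ([sum_dist_le]). In terms of generating functions,
    sum_(k, m) p_k(m) x^k y^m is dominated for k < n by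
    exp (sum_(j <= n) w_j x^j / j), with w_j = y for j in I and w_j = 1
    otherwise, and the bound is the coefficient of y^m at x = 1. The proof
    reads the recurrence as a differential inequality for P_m(x) = sum_(k < n) p_k(m) x^k, namely
    P_m' <= a' P_m + b' P_(m-1) on x >= 0, where a and b are the truncated
    logarithmic series over the lengths outside I and inside I; hence
    P_m exp(-a) <= b^m / m! by induction on m ([exp_majorant]), and a(1) = A,
    b(1) = B.

    For the last equality, H_n - ln n decreases to gamma while
    H_n - ln n - 1/n increases to gamma, so that H_n - ln n - gamma lies in
    [0, 1/n] ([euler_gamma_bounds]), and the error is at most e/n. *)

(** * Splitting a permutation along one of its cycles *)

Lemma porbit_agree (T : finType) (B : {set T}) (s u : {perm T}) :
  {in B, forall y, s y \in B} -> {in B, s =1 u} ->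
  {in B, porbit s =1 porbit u}.
Proof.
move=> sB su y yB; apply/porbit_setP.
have iterE i : iter i s y \in B /\ iter i s y = iter i u y.
  elim: i => [|i [IHB IH]] //=; split; first exact: sB.
  by rewrite su // IH.
move=> z; apply/porbitP/porbitP => -[i ->]; exists i; rewrite !permX;
  by have [] := iterE i.
Qed.

Lemma eq_imset_porbit (T : finType) (B : {set T}) (s u : {perm T}) :
  {in B, forall y, s y \in B} -> {in B, s =1 u} ->
  porbit s @: B = porbit u @: B.
Proof. by move=> sB su; apply: eq_in_imset; apply: porbit_agree. Qed.

Lemma perm_onS (T : finType) (A B : {set T}) (s : {perm T}) :
  A \subset B -> perm_on A s -> perm_on B s.
Proof. by move=> AB sA; apply: subset_trans AB. Qed.

(** Uniqueness of the decomposition of a permutation as a product of two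
    permutations with disjoint supports: restriction recovers each factor. *)
Lemma restr_permM (T : finType) (B C : {set T}) (u v : {perm T}) :
  [disjoint B & C] -> perm_on B u -> perm_on C v ->
  restr_perm B (u * v)%g = u.
Proof.
move=> dBC uB vC.
have v_id y : y \in B -> v y = y.
  by move=> yB; apply: out_perm vC _; rewrite (disjointFr dBC yB).
have stab : (u * v)%g \in 'N(B | 'P)%g.
  apply/astabsP => y /=; rewrite /aperm permM.
  have [yB|yB] := boolP (y \in B); first by rewrite v_id perm_closed.
  rewrite (out_perm uB yB); apply/negbTE/negP => vyB.
  by move: (yB); rewrite -{1}(perm_inj (v_id _ vyB)) vyB.
apply/permP => y; have [yB|yB] := boolP (y \in B); last first.
  by rewrite !(out_perm _ yB) // restr_perm_on.
by rewrite restr_permE //= permM v_id // perm_closed.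
Qed.

Section CycleIndex.
Variable T : finType.
Implicit Types (A B c : {set T}) (s u v : {perm T}).

Lemma perm_on_porbit A s x : perm_on A s -> x \in A -> porbit s x \subset A.
Proof.
move=> sA xA; apply/subsetP => y /porbitP[i ->]; rewrite permX.
by elim: i => //= i IH; rewrite perm_closed.
Qed.

(** For x in c these are the permutations of c consisting of a single cycle;
    naming a point x of c lets the cycle be recognised by one orbit. *)
Definition cyclic_on c x : pred {perm T} :=
  fun u => perm_on c u && (porbit u x == c).

Lemma porbit_mulr c A u v x : x \in c -> perm_on c u -> perm_on (A :\: c) v ->
  porbit (u * v)%g x = porbit u x.
Proof.
move=> xc uc vA.
have uvE : {in c, (u * v)%g =1 u}.
  by move=> y yc; rewrite permM (out_perm vA) // inE perm_closed // yc.
by apply: porbit_agree xc => // y yc; rewrite uvE // perm_closed.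
Qed.

Lemma perm_split A c x s : x \in A -> perm_on A s -> porbit s x = c ->
  (restr_perm c s * restr_perm (A :\: c) s)%g = s.
Proof.
move=> xA sA sc.
have stc : s \in 'N(c | 'P)%g.
  apply/astabsP => y /=; rewrite /aperm -sc -!eq_porbit_mem.
  by rewrite -[s y]/(aperm y s) -(porbit_perm s 1 y) expg1.
have stA : s \in 'N(A | 'P)%g.
  by apply/astabsP => y /=; rewrite /aperm perm_closed.
have stAc : s \in 'N(A :\: c | 'P)%g.
  by apply: (subsetP (astabsD _ _ _)); apply/setIP.
apply/permP => y; rewrite permM.
have [yc|yc] := boolP (y \in c).
  rewrite (restr_permE stc yc) (out_perm (restr_perm_on _ _)) // inE.
  by have /= -> := astabs_act y stc; rewrite yc.
rewrite (out_perm (restr_perm_on c s)) //.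
have [yA|yA] := boolP (y \in A); first by rewrite restr_permE // inE yc.
have yAc : y \notin A :\: c by rewrite inE (negbTE yA) andbF.
by rewrite (out_perm (restr_perm_on _ _) yAc) (out_perm sA yA).
Qed.

(** The permutations of A whose cycle through x has support c are exactly the
    products of a cycle on c and of a permutation of A :\: c, in a unique way:
    both factors are restrictions. *)
Lemma sum_perm_split (V : nmodType) A c x (F : {perm T} -> V) :
  x \in A -> x \in c -> c \subset A ->
  \sum_(s | perm_on A s && (porbit s x == c)) F s =
  \sum_(u | cyclic_on c x u) \sum_(v | perm_on (A :\: c) v) F (u * v)%g.
Proof.
move=> xA xc cA.
have dis : [disjoint c & A :\: c].
  by rewrite disjoints_subset; apply/subsetP => y yc; rewrite !inE yc.
rewrite pair_big /=.
rewrite (reindex_onto (fun p : {perm T} * {perm T} => (p.1 * p.2)%g)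
  (fun s => (restr_perm c s, restr_perm (A :\: c) s))) /=; last first.
  by move=> s /andP[sA /eqP sc]; apply: perm_split xA sA sc.
apply: eq_bigl => -[u v] /=; rewrite xpair_eqE /cyclic_on.
apply/idP/idP.
  case/andP=> /andP[uvA uvx] /andP[/eqP uE /eqP vE].
  have uc : perm_on c u by rewrite -uE restr_perm_on.
  have vA : perm_on (A :\: c) v by rewrite -vE restr_perm_on.
  by rewrite uc vA andbT -(porbit_mulr xc uc vA).
case/andP=> /andP[uc ux] vA.
rewrite (porbit_mulr xc uc vA) ux (restr_permM dis uc vA) eqxx andbT.
rewrite perm_onM ?(perm_onS _ uc) ?(perm_onS (subsetDl _ _) vA) //=.
have comm : (u * v = v * u)%g by apply: perm_onC uc vA dis.
by rewrite comm (restr_permM _ vA uc) // disjoint_sym.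
Qed.

Variable K : comNzRingType.
Implicit Type w : nat -> K.

Definition cycle_weight w A s : K := \prod_(c in porbit s @: A) w #|c|.

Definition cycle_index w A : K := \sum_(s | perm_on A s) cycle_weight w A s.

Lemma cycle_weight_split w A c x u v :
  x \in c -> c \subset A -> cyclic_on c x u -> perm_on (A :\: c) v ->
  cycle_weight w A (u * v)%g = w #|c| * cycle_weight w (A :\: c) v.
Proof.
move=> xc cA /andP[uc /eqP ux] vA.
have uvE : {in c, (u * v)%g =1 u}.
  by move=> y yc; rewrite permM (out_perm vA) // inE perm_closed // yc.
have uvE' : {in A :\: c, (u * v)%g =1 v}.
  by move=> y; rewrite inE => /andP[yc _]; rewrite permM (out_perm uc).
have imc : porbit (u * v)%g @: c = [set c].
  rewrite (eq_imset_porbit _ uvE); last by move=> y yc; rewrite uvE // perm_closed.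
  apply/setP => d; rewrite inE; apply/imsetP/eqP => [[y yc ->]|->].
    by apply/eqP; rewrite -[X in _ == X]ux eq_porbit_mem ux.
  by exists x.
have imA : porbit (u * v)%g @: (A :\: c) = porbit v @: (A :\: c).
  by apply: eq_imset_porbit => // y yA; rewrite uvE' // perm_closed.
rewrite /cycle_weight -{1}(setID A c) (setIidPr cA) imsetU imc imA.
rewrite big_setU1 //=; apply/imsetP => -[y yA cE].
have : y \in c by rewrite cE porbit_id.
by move: yA; rewrite inE => /andP[/negbTE ->].
Qed.

(** Summing over the support c of the cycle through x. The number of cycles on
    a given c is left abstract here: it is computed from this very identity. *)
Lemma cycle_index_split w A x : x \in A ->
  cycle_index w A =
  \sum_(c : {set T} | (x \in c) && (c \subset A))
     #|[pred u | cyclic_on c x u]|%:R * w #|c| * cycle_index w (A :\: c).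
Proof.
move=> xA; rewrite /cycle_index.
rewrite (partition_big (fun s => porbit s x) (fun c => (x \in c) && (c \subset A))) /=; last first.
  by move=> s sA; rewrite porbit_id perm_on_porbit.
apply: eq_bigr => c /andP[xc cA].
rewrite sum_perm_split // -mulrA mulr_natl -sumr_const /=.
apply: eq_bigr => u uc; rewrite mulr_sumr; apply: eq_bigr => v vA.
exact: cycle_weight_split xc cA uc vA.
Qed.

End CycleIndex.

(** * The cycle index of the symmetric group *)

Lemma cycle_index1 (T : finType) (K : comNzRingType) (A : {set T}) :
  cycle_index (fun=> 1 : K) A = (#|A|)`!%:R.
Proof.
rewrite /cycle_index (eq_bigr (fun=> 1)); last first.
  by move=> s _; rewrite /cycle_weight big1.
by rewrite sumr_const card_perm.
Qed.

(** Removing x turns these sets c into arbitrary subsets of A :\ x. *)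
Lemma sum_subset_card (T : finType) (V : nmodType) (A : {set T}) x (f : nat -> V) :
  x \in A ->
  \sum_(c : {set T} | (x \in c) && (c \subset A)) f #|c| =
  \sum_(i < #|A|) f i.+1 *+ 'C(#|A|.-1, i).
Proof.
move=> xA.
have cardA : #|A| = #|A :\ x|.+1 by rewrite (cardsD1 x A) xA.
rewrite (reindex_onto (fun d : {set T} => x |: d) (fun c => c :\ x)) /=; last first.
  by move=> c /andP[xc _]; rewrite setD1K.
rewrite (eq_bigl (fun d : {set T} => d \subset A :\ x)); last first.
  move=> d; rewrite setU11 subUset sub1set xA /= subsetD1.
  case: (d \subset A) => //=; apply/eqP/idP => [<-|/setU1K //].
  by rewrite !inE eqxx.
rewrite (eq_bigr (fun d : {set T} => f #|d|.+1)); last first.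
  by move=> d; rewrite subsetD1 => /andP[_ xd]; rewrite cardsU1 xd.
rewrite (partition_big (fun d : {set T} => inord #|d| : 'I_(#|A :\ x|.+1)) predT) //=.
rewrite [in RHS]cardA /=; apply: eq_bigr => i _.
rewrite -(cards_draws (A :\ x) i) -sumr_const.
rewrite [RHS](eq_bigl (fun d : {set T} => (d \subset A :\ x) && (#|d| == i :> nat))); last first.
  by move=> d; rewrite inE.
apply: eq_big => [d|d /andP[dA /eqP <-]].
  have [dA|//] /= := boolP (d \subset A :\ x).
  by rewrite -val_eqE /= inordK // ltnS subset_leq_card.
by rewrite inordK // ltnS subset_leq_card.
Qed.

(** Strong induction on c. With all weights equal to 1, the splitting identity
    says that the numbers of cycles N_d, for x in d and d included in c, satisfy
    sum_d N_d (#|c| - #|d|)! = #|c|!. The numbers (#|d| - 1)! satisfy the same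
    identity, because there are 'C(#|c| - 1, i) sets d with i + 1 elements. The
    two sums agree term by term on proper subsets by induction, hence also on
    the term d = c. *)
Lemma card_cyclic_on (T : finType) (c : {set T}) x : x \in c ->
  #|[pred u | cyclic_on c x u]| = #|c|.-1`!.
Proof.
have [k] := ubnP #|c|; elim: k => // k IHk in c x *; rewrite ltnS => ck xc.
have ccard : #|c| = #|c|.-1.+1 by rewrite prednK // card_gt0; apply/set0Pn; exists x.
pose g j := ((j.-1)`! * (#|c| - j)`!)%N.
have sumg : (\sum_(d : {set T} | (x \in d) && (d \subset c)) g #|d| = (#|c|)`!)%N.
  have /= -> := @sum_subset_card T nat c x g xc.
  rewrite (eq_bigr (fun=> #|c|.-1`!)); last first.
    move=> i _; rewrite /g /=.
    have ic : (i <= #|c|.-1)%N by rewrite -ltnS -ccard.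
    have -> : (#|c| - i.+1 = #|c|.-1 - i)%N by rewrite -subn1 -subnDA add1n.
    by rewrite -mulr_natr natn -(bin_fact ic); apply: mulnC.
  rewrite sumr_const card_ord -mulr_natr natn [in RHS]ccard factS -ccard.
  exact: mulnC.
have sumN : (\sum_(d : {set T} | (x \in d) && (d \subset c))
    #|[pred u | cyclic_on d x u]| * (#|c| - #|d|)`! = (#|c|)`!)%N.
  apply/eqP; rewrite -(eqr_nat int) natr_sum -cycle_index1 (cycle_index_split _ xc).
  apply/eqP; apply: eq_bigr => d /andP[xd dc].
  by rewrite cycle_index1 mulr1 cardsD (setIidPr dc) -natrM.
have cc : (x \in c) && (c \subset c) by rewrite xc subxx.
move: sumN; rewrite -sumg (bigD1 c) //= [in RHS](bigD1 c) //= /g subnn !muln1.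
set S1 := (\sum_(d | _) _)%N; set S2 := (\sum_(d | _) _)%N.
suff -> : S1 = S2 by move/addIn.
apply: eq_bigr => d /andP[/andP[xd dc] ndc].
by rewrite (IHk d x) // (leq_trans _ ck) // proper_card // properEneq ndc.
Qed.

Lemma cycle_index_set0 (T : finType) (K : comNzRingType) (w : nat -> K) :
  cycle_index w (set0 : {set T}) = 1.
Proof.
rewrite -[RHS]/(0`!%:R) -(cards0 T) -cycle_index1.
by apply: eq_bigr => s _; rewrite /cycle_weight imset0 !big_set0.
Qed.

(** The hypothesis on g is the induction hypothesis of [cycle_indexE]. *)
Lemma cycle_index_step (T : finType) (K : comNzRingType) (w : nat -> K)
    (A : {set T}) (g : nat -> K) : (0 < #|A|)%N ->
  (forall B : {set T}, (#|B| < #|A|)%N -> cycle_index w B = g #|B|) ->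
  cycle_index w A =
  \sum_(i < #|A|) ('C(#|A|.-1, i) * i`!)%:R * w i.+1 * g (#|A| - i.+1)%N.
Proof.
rewrite card_gt0 => /set0Pn[x xA] gE; rewrite (cycle_index_split w xA).
rewrite (eq_bigr (fun c : {set T} =>
    (#|c|.-1`!)%:R * w #|c| * g (#|A| - #|c|)%N)); last first.
  move=> c /andP[xc cA]; rewrite card_cyclic_on // gE cardsD (setIidPr cA) //.
  by rewrite -subn_gt0 subKn ?subset_leq_card // card_gt0; apply/set0Pn; exists x.
pose f j := (j.-1`!)%:R * w j * g (#|A| - j)%N.
have /= -> := sum_subset_card f xA.
by apply: eq_bigr => i _; rewrite /f -[LHS]mulr_natl natrM -!mulrA.
Qed.

Definition sym_index (K : comNzRingType) (w : nat -> K) k :=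
  cycle_index w [set: 'I_k].

(** The splitting identity is a recurrence that sees a set only through its
    cardinality. *)
Lemma cycle_indexE (T : finType) (K : comNzRingType) (w : nat -> K) (A : {set T}) :
  cycle_index w A = sym_index w #|A|.
Proof.
have [k] := ubnP #|A|; elim: k => // k IHk in T A *; rewrite ltnS => Ak.
have [A0|Agt0] := posnP #|A|.
  rewrite A0 /sym_index (cards0_eq A0) cycle_index_set0.
  by rewrite (_ : [set: 'I_0] = set0) ?cycle_index_set0 //; apply/setP => -[].
rewrite /sym_index (@cycle_index_step _ _ w A (sym_index w)) //; last first.
  by move=> B BA; apply/IHk/(leq_trans BA).
rewrite (@cycle_index_step _ _ w _ (sym_index w)); rewrite ?cardsT ?card_ord //.
by move=> B BA; apply/IHk/(leq_trans BA).
Qed.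

Lemma sym_index0 (K : comNzRingType) (w : nat -> K) : sym_index w 0 = 1.
Proof.
have T0 : [set: 'I_0] = set0 by apply/setP => -[].
by rewrite /sym_index T0 cycle_index_set0.
Qed.

Lemma sym_indexS (K : comNzRingType) (w : nat -> K) k :
  sym_index w k.+1 =
  \sum_(i < k.+1) ('C(k, i) * i`!)%:R * w i.+1 * sym_index w (k - i).
Proof.
rewrite {1}/sym_index (@cycle_index_step _ _ w _ (sym_index w)).
- by rewrite cardsT card_ord.
- by rewrite cardsT card_ord.
by move=> B _; apply: cycle_indexE.
Qed.

(** The predicate L is indexed by length minus one, so L i speaks of the length
    i.+1, in agreement with the indexing of the harmonic sequence. *)
Definition marked_var (R : nzRingType) (L : pred nat) (j : nat) : {poly R} :=
  if L j.-1 then 'X else 1.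

Definition cycle_dist (R : fieldType) (L : pred nat) (k m : nat) : R :=
  (sym_index (marked_var R L) k)`_m / k`!%:R.

Lemma cycle_dist0 (R : fieldType) L m : cycle_dist R L 0 m = (m == 0%N)%:R.
Proof. by rewrite /cycle_dist sym_index0 coef1 divr1. Qed.

(** A coefficient of [sym_indexS], the factorials cancelling the binomial: the
    factor 'C(k, i) i! / k! is 1 / (k - i)!. *)
Lemma cycle_distS (R : numFieldType) L k m :
  k.+1%:R * cycle_dist R L k.+1 m =
  \sum_(i < k.+1) (if L i then (if m is m'.+1 then cycle_dist R L (k - i) m' else 0)
                   else cycle_dist R L (k - i) m).
Proof.
have fact_neq0 j : j`!%:R != 0 :> R by rewrite pnatr_eq0 -lt0n fact_gt0.
rewrite /cycle_dist sym_indexS factS natrM invfM mulrCA mulVKf ?pnatr_eq0 //.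
rewrite coef_sum mulr_suml; apply: eq_bigr => i _.
have ik : (i <= k)%N by rewrite -ltnS.
have cE : ('C(k, i) * i`!)%:R / k`!%:R = (k - i)`!%:R^-1 :> R.
  apply: (mulIf (fact_neq0 (k - i)%N)); rewrite mulVf // mulrAC -natrM -mulnA.
  by rewrite bin_fact // divff.
rewrite -mulrA -polyC_natr coefCM mulrAC cE mulrC {1}/marked_var /=.
case: (L i); last by rewrite mul1r.
by rewrite coefXM; case: m => [|m] //=; rewrite mul0r.
Qed.

Lemma sym_index_coef (R : comNzRingType) (L : pred nat) (k m : nat) :
  (sym_index (marked_var R L) k)`_m =
  #|[set s : 'S_k | #|[set c in porbits s | L #|c|.-1]| == m]|%:R.
Proof.
rewrite /sym_index /cycle_index coef_sum (eq_bigl predT); last first.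
  by move=> s; apply/subsetP => x _; rewrite inE.
rewrite -sum1dep_card natr_sum [RHS]big_mkcond /=; apply: eq_bigr => s _.
have -> : cycle_weight (marked_var R L) [set: 'I_k] s =
          'X^#|[set c in porbits s | L #|c|.-1]|.
  rewrite /cycle_weight /marked_var -big_mkcondr /= prodr_const; congr ('X^_).
  apply: eq_card => c; rewrite [in RHS]inE; congr (_ && _).
  by rewrite /porbits; apply/imsetP/imsetP => -[y _ ->]; exists y; rewrite ?inE.
by rewrite coefXn eq_sym; case: eqP.
Qed.

(** * Bounding the partial sums by a differential inequality *)

Lemma is_derive_horner (R : realType) (p : {poly R}) (x : R) :
  is_derive x 1 (horner p) p^`().[x].
Proof.
by rewrite derive.derivE derive1E; apply/derivableP/derivable_horner.
Qed.

Lemma horner_ge0 (R : numDomainType) (p : {poly R}) (x : R) :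
  (forall i, 0 <= p`_i) -> 0 <= x -> 0 <= p.[x].
Proof.
move=> p0 x0; rewrite horner_coef; apply: sumr_ge0 => i _.
by rewrite mulr_ge0 // exprn_ge0.
Qed.

(** Gronwall's argument: the derivative of Q - P exp(-a) is nonnegative, and
    this function vanishes at 0. *)
Lemma poly_gronwall (R : realType) (P Q a : {poly R}) (y : R) :
  P.[0] = Q.[0] -> a.[0] = 0 -> 0 <= y ->
  (forall x, 0 <= x ->
     P^`().[x] <= a^`().[x] * P.[x] + Q^`().[x] * expR a.[x]) ->
  P.[y] <= Q.[y] * expR a.[y].
Proof.
move=> PQ0 a0 y0 dP.
pose E : R -> R := expR \o horner (- a).
pose f : R -> R := horner Q - horner P * E.
pose df x : R := Q^`().[x] - (P.[x] * (E x * - a^`().[x]) + E x * P^`().[x]).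
have fE (x : R) : is_derive x 1 f (df x).
  have dE : is_derive x 1 E (E x * - a^`().[x]).
    have := is_derive_horner (- a) x; rewrite derivN hornerN => dNa.
    exact: is_derive1_comp.
  have dPx := is_derive_horner P x; have dQx := is_derive_horner Q x.
  exact: is_deriveB.
have cf : {within `[0, y], continuous f}%classic.
  apply: continuous_subspaceT => x.
  by apply/differentiable_continuous/derivable1_diffP; have [] := fE x.
have [c /itvP cy] := MVT_segment y0 (fun x _ => fE x) cf.
have fval z : f z = Q.[z] - P.[z] * expR (- a.[z]) by rewrite /f /E !fctE /= hornerN.
have f0 : f 0 = 0 by rewrite fval a0 oppr0 expR0 mulr1 PQ0 subrr.
rewrite f0 !subr0 => fy.
have dfc : 0 <= df c.
  rewrite /df /E /= hornerN -subr_ge0 subr0 subr_ge0.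
  have -> : P.[c] * (expR (- a.[c]) * - a^`().[c]) + expR (- a.[c]) * P^`().[c] =
            (P^`().[c] - a^`().[c] * P.[c]) * expR (- a.[c]) by ring.
  rewrite expRN ler_pdivrMr ?expR_gt0 // lerBlDl dP // ?cy //.
have : 0 <= f y by rewrite fy mulr_ge0.
by rewrite fval subr_ge0 expRN ler_pdivrMr ?expR_gt0.
Qed.

(** Induction on m, comparing P m with Q = b^m / m!, for which
    Q' = b' b^(m-1) / (m-1)!; the induction hypothesis bounds the term
    b' P_(m-1) by Q' exp(a). *)
Lemma exp_majorant (R : realType) (P : nat -> {poly R}) (a b : {poly R}) :
  a.[0] = 0 -> b.[0] = 0 ->
  (forall i, 0 <= b^`()`_i) ->
  (forall m, (P m).[0] = (m == 0%N)%:R) ->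
  (forall m x, 0 <= x -> (P m)^`().[x] <=
     a^`().[x] * (P m).[x] + (if m is m'.+1 then b^`().[x] * (P m').[x] else 0)) ->
  forall m y, 0 <= y -> (P m).[y] <= b.[y] ^+ m / m`!%:R * expR a.[y].
Proof.
move=> a0 b0 bge0 P0 dP.
have QE m x : ((m`!%:R^-1)%:P * b ^+ m).[x] = b.[x] ^+ m / m`!%:R.
  by rewrite hornerM hornerC horner_exp mulrC.
elim=> [|m IHm] y y0; rewrite -QE.
  apply: poly_gronwall => // [|x x0].
    by rewrite P0 QE expr0 fact0 invr1 mulr1.
  by rewrite expr0 mulr1 derivC horner0 mul0r; apply: (dP 0%N).
apply: poly_gronwall => // [|x x0].
  by rewrite P0 QE b0 expr0n mul0r.
apply: le_trans (dP m.+1 x x0) _; rewrite lerD2l.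
have -> : ((m.+1`!%:R^-1)%:P * b ^+ m.+1)^`().[x] =
          b^`().[x] * (b.[x] ^+ m / m`!%:R).
  rewrite derivM derivC mul0r add0r deriv_exp hornerM hornerC hornerMn hornerM.
  rewrite horner_exp /= factS natrM -mulr_natr.
  field.
  by rewrite nat1r !pnatr_eq0 -lt0n fact_gt0.
by rewrite -mulrA ler_wpM2l ?IHm // horner_ge0.
Qed.

(** The truncated logarithmic series restricted to M: its derivative is the sum
    of x^i over the i < n such that M i. *)
Definition harmonic_poly (R : realType) n (M : pred nat) : {poly R} :=
  \poly_(k < n.+1) (if k is i.+1 then (M i)%:R * harmonic i else 0).

Section HarmonicPoly.
Variables (R : realType) (n : nat).
Implicit Type M : pred nat.

Lemma harmonic_poly0 M : (harmonic_poly R n M).[0] = 0.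
Proof. by rewrite horner_coef0 coef_poly. Qed.

Lemma harmonic_poly1 M :
  (harmonic_poly R n M).[1] = \sum_(i < n | M i) harmonic i.
Proof.
rewrite horner_poly big_ord_recl mul0r add0r [RHS]big_mkcond /=.
by apply: eq_bigr => i _; rewrite expr1n mulr1; case: (M i); rewrite ?mul1r ?mul0r.
Qed.

Lemma coef_deriv_harmonic_poly M i :
  (harmonic_poly R n M)^`()`_i = ((i < n)%N && M i)%:R.
Proof.
rewrite coef_deriv coef_poly ltnS; case: ltnP => _ /=; last by rewrite mul0rn.
by rewrite -[LHS]mulr_natr divfK ?pnatr_eq0.
Qed.

(** The differential inequality required by [exp_majorant] holds coefficient by
    coefficient for the polynomials with coefficients p k m, k < n: in degree
    k < n - 1 it is an equality, which is the recurrence for k + 1, and in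
    higher degrees the derivative contributes 0. *)
Lemma sum_dist_le (L : pred nat) (p : nat -> nat -> R) :
  (forall k m, 0 <= p k m) -> (forall m, p 0%N m = (m == 0%N)%:R) ->
  (forall k m, k.+1%:R * p k.+1 m =
     \sum_(i < k.+1) (if L i then (if m is m'.+1 then p (k - i)%N m' else 0)
                      else p (k - i)%N m)) ->
  forall m, \sum_(k < n) p k m <=
    (\sum_(i < n | L i) harmonic i) ^+ m / m`!%:R *
    expR (\sum_(i < n | ~~ L i) harmonic i).
Proof.
move=> p0 pinit prec m; have [->|n0] := posnP n.
  by rewrite !big_ord0 expR0 mulr1 expr0n mulr_ge0 ?invr_ge0.
pose P m := \poly_(k < n) p k m.
pose a := harmonic_poly R n (predC L); pose b := harmonic_poly R n L.
have Pge0 j i : 0 <= (P j)`_i by rewrite coef_poly; case: ifP.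
have dge0 M i : 0 <= (harmonic_poly R n M)^`()`_i by rewrite coef_deriv_harmonic_poly.
have -> : \sum_(k < n) p k m = (P m).[1].
  by rewrite horner_poly; apply: eq_bigr => k _; rewrite expr1n mulr1.
rewrite -(harmonic_poly1 L) -(harmonic_poly1 (predC L)) -/a -/b.
apply: exp_majorant; rewrite ?ler01 //; try exact: harmonic_poly0.
- exact: dge0.
- by move=> j; rewrite horner_coef0 coef_poly n0 pinit.
move=> {}m x x0.
(* The right-hand side has to be the value of one polynomial before comparing
   coefficients. *)
pose B := if m is m'.+1 then b^`() * P m' else 0.
have -> : (if m is m'.+1 then b^`().[x] * (P m').[x] else 0) = B.[x].
  by rewrite /B; case: (m) => [|m']; rewrite ?horner0 ?hornerM.
rewrite -subr_ge0 -hornerM -hornerD -hornerN -hornerD; apply: horner_ge0 => // k.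
have Bge0 : 0 <= B`_k.
  rewrite /B; case: (m) => [|m']; rewrite ?coef0 // coefM.
  by apply: sumr_ge0 => i _; apply: mulr_ge0 => //; apply: dge0.
have age0 : 0 <= (a^`() * P m)`_k.
  by rewrite coefM; apply: sumr_ge0 => i _; apply: mulr_ge0 => //; apply: dge0.
rewrite !coefD coefN coef_deriv coef_poly.
case: ltnP => [kn|_]; last by rewrite mul0rn subr0 addr_ge0.
rewrite -mulr_natl prec subr_ge0 /B.
have convE (M : pred nat) j : ((harmonic_poly R n M)^`() * P j)`_k =
    \sum_(i < k.+1) (M i)%:R * p (k - i)%N j.
  rewrite coefM; apply: eq_bigr => i _.
  rewrite coef_deriv_harmonic_poly coef_poly.
  have ik : (i <= k)%N by rewrite -ltnS.
  have -> : (i < n)%N by apply: leq_ltn_trans (ltnW kn).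
  by have -> : (k - i < n)%N by apply: leq_ltn_trans (leq_subr _ _) (ltnW kn).
rewrite convE; case: (m) => [|m']; rewrite ?coef0 ?addr0 ?convE -?big_split /=;
  apply: ler_sum => i _; case: (L i); rewrite /= ?mul1r ?mul0r ?add0r ?addr0 //.
Qed.

End HarmonicPoly.

(** * Harmonic numbers and Euler's constant *)

Lemma ln_sub_le (R : realType) (x y : R) : 0 < x -> 0 < y ->
  ln y - ln x <= (y - x) / x.
Proof.
move=> x0 y0; rewrite -ln_div ?posrE //.
have -> : (y - x) / x = y / x - 1 by field; rewrite gt_eqF.
have yx0 : 0 < y / x by rewrite divr_gt0.
have := @le_ln1Dx R (y / x - 1); rewrite (addrC 1) subrK; apply.
by rewrite ltrBrDr addNr.
Qed.

Lemma lnS_bounds (R : realType) (n : nat) :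
  n.+2%:R^-1 <= ln n.+2%:R - ln n.+1%:R :> R /\
  ln n.+2%:R - ln n.+1%:R <= n.+1%:R^-1 :> R.
Proof.
have h1 : 0 < n.+1%:R :> R by []; have h2 : 0 < n.+2%:R :> R by [].
split; last first.
  apply: le_trans (ln_sub_le h1 h2) _.
  by rewrite -natrB // subSnn div1r.
rewrite -lerN2 opprB; apply: le_trans (ln_sub_le h2 h1) _.
by rewrite -opprB -natrB // subSnn mulNr div1r.
Qed.

(** The monotonicity of the two sequences below comes from
    1/(n+1) <= ln (n+1) - ln n <= 1/n. The decreasing H_n - ln n and the
    increasing H_n - ln n - 1/n differ by 1/n, so that they share the limit
    gamma and enclose it. *)
Lemma euler_gamma_bounds (R : realType) (n : nat) : (0 < n)%N ->
  0 <= Hnum R n - ln n%:R - euler_gamma R <= n%:R^-1.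
Proof.
case: n => // n _.
(* Shifted by one because H_n - ln n is monotone only from n = 1 on: at n = 0
   it takes the value 0. *)
pose u k : R := Hnum R k.+1 - ln k.+1%:R.
pose v k : R := u k - harmonic k.
have HS k : Hnum R k.+1 = Hnum R k + k.+1%:R^-1.
  by rewrite /Hnum /series /= big_nat_recr.
have u_dec : nonincreasing_seq u.
  apply/nonincreasing_seqP => k; have [lo _] := lnS_bounds R k.
  rewrite /u HS; move: lo.
  by move: (_^-1) (ln _) (ln _) (Hnum _ _) => a b c d; lra.
have v_inc : nondecreasing_seq v.
  apply/nondecreasing_seqP => k; have [_ hi] := lnS_bounds R k.
  rewrite /v /u (HS k.+1) /=; move: hi.
  by move: (k.+1%:R^-1) (k.+2%:R^-1) (ln _) (ln _) (Hnum _ _) => a b c d e; lra.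
have v0 : v 0%N = 0.
  by rewrite /v /u HS /Hnum /series /= big_geq // ln1 invr1; ring.
have u_cvg : cvgn u.
  apply: nonincreasing_is_cvgn => //; exists 0 => _ [k _ <-].
  rewrite -v0; apply: le_trans (v_inc _ _ (leq0n k)) _.
  by rewrite /v gerBl harmonic_ge0.
have uE : (u @ \oo --> limn u)%classic by [].
have vE : (v @ \oo --> limn u)%classic.
  by rewrite -[limn u]subr0; apply: cvgB => //; apply: cvg_harmonic.
have gE : euler_gamma R = limn u.
  apply/cvg_lim => //; rewrite -(cvg_shiftS (fun k => Hnum R k - ln k%:R)).
  exact: uE.
have := nonincreasing_cvgn_ge u_dec u_cvg n.
have := nondecreasing_cvgn_le v_inc (cvgP _ vE) n.
rewrite (cvg_lim _ vE) // gE /v /u /=.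
by move=> lo hi; rewrite subr_ge0 hi lerBlDl -lerBlDr lo.
Qed.

(** Since exp(d) - 1 = exp(d) (1 - exp(-d)), with exp(d) <= e and
    1 - exp(-d) <= d. *)
Lemma expR_sub1_bounds (R : realType) (d : R) : 0 <= d <= 1 ->
  `|expR d - 1| <= expR 1 * d.
Proof.
case/andP=> d0 d1.
have eN := expR_ge1Dx (- d); have e1 := expR_ge1Dx d.
rewrite ger0_norm; last by lra.
have : expR d * (1 - expR (- d)) <= expR 1 * d.
  by apply: ler_pM; rewrite ?expR_ge0 ?ler_expR //; [rewrite subr_ge0 -expR0 ler_expR; lra|lra].
by rewrite mulrBr mulr1 -expRD subrr expR0.
Qed.

Lemma expR_Hnum (R : realType) (n : nat) (h : R) : (0 < n)%N ->
  exists eps : R, `|eps| <= expR 1 / n%:R /\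
    expR (Hnum R n - h) / n%:R = expR (euler_gamma R - h) * (1 + eps).
Proof.
move=> n0; have /andP[d0 d1] := euler_gamma_bounds R n0.
set d := Hnum R n - ln n%:R - euler_gamma R in d0 d1.
have n_gt0 : 0 < n%:R :> R by rewrite ltr0n.
exists (expR d - 1); split.
  apply: le_trans (expR_sub1_bounds _) _.
    by rewrite d0 (le_trans d1) // invf_le1 // ler1n.
  by rewrite ler_wpM2l ?expR_ge0.
rewrite (addrC 1) subrK -expRD -[X in _ / X]lnK ?posrE // -expRB.
by congr expR; rewrite /d; ring.
Qed.

(** * The number of cycles with lengths in I *)

Definition marks n (I : {set 'I_n}) (i : nat) : bool := [exists j in I, i == j :> nat].

Lemma marks_ord n (I : {set 'I_n}) (i : 'I_n) : marks I i = (i \in I).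
Proof.
apply/existsP/idP => [[j /andP[jI /eqP/val_inj ->]] //|iI].
by exists i; rewrite iI eqxx.
Qed.

Lemma cycle_countE n (I : {set 'I_n}) (s : 'S_n) :
  cycle_count I s = #|[set c in porbits s | marks I #|c|.-1]|.
Proof.
apply: eq_card => c; rewrite !inE; apply: andb_id2l => /imsetP[x _ ->].
apply: eq_existsb => j; congr (_ && _).
by rewrite -[in LHS](prednK (n := #|porbit s x|)) ?eqSS // lt0n card_porbit_neq0.
Qed.

Lemma uniform_prob_cycle_count (R : realType) n (I : {set 'I_n}) m :
  uniform_prob R (fun s : 'S_n => cycle_count I s == m) =
  cycle_dist R (marks I) n m.
Proof.
rewrite /uniform_prob /cycle_dist sym_index_coef; congr (_%:R / _%:R).
  by apply: eq_card => s; rewrite !inE cycle_countE.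
by rewrite -card_Sn; apply: eq_card => s; rewrite inE.
Qed.

Lemma cycle_dist_ge0 (R : realType) L k m : 0 <= cycle_dist R L k m.
Proof. by rewrite /cycle_dist sym_index_coef divr_ge0. Qed.

Lemma Hset_marks (R : realType) n (I : {set 'I_n}) :
  \sum_(i < n | marks I i) harmonic i = Hset R I.
Proof. by apply: eq_bigl => i; rewrite marks_ord. Qed.

Lemma Hnum_sub_Hset (R : realType) n (I : {set 'I_n}) :
  \sum_(i < n | ~~ marks I i) harmonic i = Hnum R n - Hset R I.
Proof.
rewrite /Hnum /series /= big_mkord [in RHS](bigID (fun i : 'I_n => marks I i)) /=.
by rewrite -[Hset R I]Hset_marks [RHS]addrAC subrr add0r.
Qed.

Lemma Hset_gt0 (R : realType) n (I : {set 'I_n}) : I != set0 -> 0 < Hset R I.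
Proof.
case/set0Pn=> i iI; rewrite /Hset (bigD1 i) //=.
by rewrite ltr_pwDl ?invr_gt0 // sumr_ge0 // => j _; rewrite invr_ge0.
Qed.

(** In the recurrence for n every index k < n occurs once, either with m - 1 or
    with m; extending both sums to all k < n only adds nonnegative terms. If I
    is everything, m does not occur at all on the right. *)
Lemma cycle_dist_le (R : realType) n (I : {set 'I_n}) m : (0 < n)%N ->
  n%:R * cycle_dist R (marks I) n m <=
  (if m is m'.+1 then \sum_(k < n) cycle_dist R (marks I) k m' else 0) +
  (I != [set: 'I_n])%:R * \sum_(k < n) cycle_dist R (marks I) k m.
Proof.
case: n I => // n I _; rewrite cycle_distS.
set p := cycle_dist R (marks I).
have p0 k j : 0 <= p k j by apply: cycle_dist_ge0.
have rev j : \sum_(k < n.+1) p k j = \sum_(i < n.+1) p (n - i)%N j.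
  by rewrite (reindex_inj rev_ord_inj).
have -> : (if m is m'.+1 then \sum_(k < n.+1) p k m' else 0) =
    \sum_(i < n.+1) (if m is m'.+1 then p (n - i)%N m' else 0).
  by case: (m) => [|m']; rewrite ?rev // big1.
rewrite rev mulr_sumr -big_split; apply: ler_sum => i _ /=; rewrite marks_ord.
have [iI|iI] := boolP (i \in I); first by rewrite lerDl mulr_ge0.
have -> : I != [set: 'I_n.+1] by apply: contraNneq iI => ->; rewrite inE.
by rewrite mul1r lerDr; case: (m).
Qed.

Lemma cycle_count_prob_le (R : realType) n (I : {set 'I_n}) m :
  (0 < n)%N -> I != set0 ->
  uniform_prob R (fun s : 'S_n => cycle_count I s == m) <=
    expR (Hnum R n - Hset R I) / n%:R * (Hset R I ^+ m / m`!%:R) *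
    ((I != [set: 'I_n])%:R + m%:R / Hset R I).
Proof.
move=> n0 I0; rewrite uniform_prob_cycle_count.
have nR0 : 0 < n%:R :> R by rewrite ltr0n.
have B0 := Hset_gt0 R I0.
have bound j := @sum_dist_le R n (marks I) _ (cycle_dist_ge0 R (marks I))
  (cycle_dist0 R (marks I)) (cycle_distS R (marks I)) j.
move: bound; rewrite Hset_marks Hnum_sub_Hset => bound.
rewrite -(ler_pM2l nR0); apply: le_trans (cycle_dist_le R I m n0) _.
set E := expR _ in bound *; set B := Hset R I in B0 bound *.
have -> : n%:R * (E / n%:R * (B ^+ m / m`!%:R) * ((I != [set: 'I_n])%:R + m%:R / B)) =
   B ^+ m / m`!%:R * (m%:R / B) * E + (I != [set: 'I_n])%:R * (B ^+ m / m`!%:R * E).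
  by field; rewrite !gt_eqF ?ltr0n ?fact_gt0.
apply: lerD; last by rewrite ler_wpM2l.
case: m => [|m]; first by rewrite !mul0r mulr0 mul0r.
apply: le_trans (bound m) _; rewrite le_eqVlt; apply/orP; left; apply/eqP.
rewrite factS natrM exprS; field.
by rewrite nat1r !gt_eqF ?ltr0n ?fact_gt0.
Qed.

Theorem corollary1p6 (R : realType) :
  (forall (n : nat) (I : {set 'I_n}) (m : nat),
     (1 <= n)%N -> I != set0 ->
     uniform_prob R (fun s : 'S_n => cycle_count I s == m) <=
       expR (Hnum R n - Hset R I) / n%:R * (Hset R I ^+ m / m`!%:R) *
       ((I != [set: 'I_n])%:R + m%:R / Hset R I))
  /\
  (exists C : R, forall (n : nat) (I : {set 'I_n}),
     (1 <= n)%N -> I != set0 ->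
     uniform_prob R (fun s : 'S_n => cycle_count I s == 0%N) <=
       expR (Hnum R n - Hset R I) / n%:R
     /\ exists eps : R, `|eps| <= C / n%:R /\
          expR (Hnum R n - Hset R I) / n%:R =
            expR (euler_gamma R - Hset R I) * (1 + eps)).
Proof.
split=> [n I m|]; first exact: cycle_count_prob_le.
exists (expR 1) => n I n0 I0; split; last exact: expR_Hnum.
apply: le_trans (cycle_count_prob_le R 0 n0 I0) _.
rewrite expr0 fact0 divr1 mulr1 mul0r addr0 ler_piMr ?lern1 ?leq_b1 //.
by rewrite divr_ge0 ?expR_ge0.
Qed.
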